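(* Let $x_0 > x_1$ be positive integers. The number of steps required to carry out the Euclidean algorithm for the pair $(x_0,x_1)$ using the regular method and the number of steps required using the method of least absolute remainders are the same.
   Context: Let $x_0>x_1$ be positive integers. A general Euclidean algorithm for the pair $(x_0,x_1)$ is a finite list of $m\ge 1$ equations $$x_{i-1}=x_i p_i+\epsilon_{i+1}x_{i+1}\quad (1\le i\le m-1),\qquad x_{m-1}=x_m p_m,$$ where all $x_i$ are positive integers with $x_{i+1}<x_i$ for all $0\le i\le m-1$, all $p_i$ are positive integers, and each $\epsilon_i\in\{+1,-1\}$ $(2\le i\le m)$. (If $x_1$ divides $x_0$ the list consists of the single equation $x_0=x_1p_1$.) The number of steps of such an algorithm is $(m-1)+\sum_{i=1}^m p_i$ (each subtraction counts as one step, and each passage from the pair $(x_{i-1},x_i)$ to the pair $(x_i,x_{i+1})$ counts as one step). The regular Euclidean algorithm (regular method) is the one in which all $\epsilon_i=+1$. The method of least absolute remainders is the general Euclidean algorithm in which the remainder of smaller absolute value is chosen at each step, i.e. $2x_i\le x_{i-1}$ for all $i=2,\dots,m$; when both possible remainders have the same absolute value (i.e. $2x_i=x_{i-1}$), the positive remainder is chosen, i.e. $\epsilon_i=+1$. *)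

(* Defs.v *)
From mathcomp Require Import all_boot all_order all_algebra.
From mathcomp Require Import zify.

Set Implicit Arguments.
Unset Strict Implicit.
Unset Printing Implicit Defensive.

Import GRing.Theory.

(* The list of m = ea_len equations is stored through total functions on nat;
   only the x_i = ea_rem i (0 <= i <= m), p_i = ea_quo i (1 <= i <= m) and
   epsilon_i = ea_sgn i (2 <= i <= m) are constrained or used. *)
Record euclid_algorithm (x0 x1 : nat) := EuclidAlgorithm {
  ea_len : nat;
  ea_rem : nat -> nat;
  ea_quo : nat -> nat;
  ea_sgn : nat -> int;
  len_gt0 : 1 <= ea_len;
  rem_0 : ea_rem 0 = x0;
  rem_1 : ea_rem 1 = x1;
  rem_gt0 : forall i, i <= ea_len -> 0 < ea_rem i;
  rem_decr : forall i, i <= ea_len - 1 -> ea_rem i.+1 < ea_rem i;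
  quo_gt0 : forall i, 1 <= i <= ea_len -> 0 < ea_quo i;
  sgn_pm1 : forall i, 2 <= i <= ea_len -> ea_sgn i = 1%R \/ ea_sgn i = (-1)%R;
  eqn_step : forall i, 1 <= i <= ea_len - 1 ->
    ((ea_rem (i - 1))%:Z =
       (ea_rem i)%:Z * (ea_quo i)%:Z + ea_sgn i.+1 * (ea_rem i.+1)%:Z)%R;
  eqn_last : ea_rem (ea_len - 1) = ea_rem ea_len * ea_quo ea_len
}.

Definition nb_steps x0 x1 (A : euclid_algorithm x0 x1) : nat :=
  (ea_len A - 1) + \sum_(1 <= i < (ea_len A).+1) ea_quo A i.

Definition regular_method x0 x1 (A : euclid_algorithm x0 x1) : Prop :=
  forall i, 2 <= i <= ea_len A -> ea_sgn A i = 1%R.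

Definition least_abs_rem_method x0 x1 (A : euclid_algorithm x0 x1) : Prop :=
  forall i, 2 <= i <= ea_len A ->
    2 * ea_rem A i <= ea_rem A (i - 1) /\
    (2 * ea_rem A i = ea_rem A (i - 1) -> ea_sgn A i = 1%R).

(* The lemmas below show that both methods apply to every pair, so that
   quantifying over the algorithms that follow them is never vacuous. *)

Lemma euclid_single x0 x1 : 0 < x1 < x0 -> x1 %| x0 ->
  exists A : euclid_algorithm x0 x1, ea_len A = 1.
Proof.
move=> /andP[x1_gt0 lt10] dv.
have q_gt0 : 0 < x0 %/ x1 by rewrite divn_gt0 // ltnW.
have E : x0 = x1 * (x0 %/ x1) by rewrite mulnC divnK.
unshelve eexists (@EuclidAlgorithm x0 x1 1
  (fun i => if i is 0 then x0 else x1) (fun=> x0 %/ x1) (fun=> 1%R)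
  _ _ _ _ _ _ _ _ _) => //=.
- by move=> [|i] _; rewrite ?(leq_trans _ lt10).
- by move=> [|i].
- by move=> i _; left.
- by move=> [|i]; rewrite ?subnn.
Qed.

Lemma euclid_cons x0 x1 x2 q (e : int) (B : euclid_algorithm x1 x2) :
    0 < x1 < x0 -> 0 < q -> (e = 1 \/ e = -1)%R ->
    (x0%:Z = x1%:Z * q%:Z + e * x2%:Z)%R ->
  exists A : euclid_algorithm x0 x1,
    [/\ ea_len A = (ea_len B).+1, forall i, ea_rem A i.+1 = ea_rem B i, ea_sgn A 2 = e
      & forall i, ea_sgn A i.+3 = ea_sgn B i.+2].
Proof.
case: B => n r p s /= n0 r0 r1 rp rd pp sp es el /andP[x1_gt0 lt10] q0 he E.
unshelve eexists (@EuclidAlgorithm x0 x1 n.+1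
  (fun i => if i is j.+1 then r j else x0)
  (fun i => if i is j.+2 then p j.+1 else q)
  (fun i => if i is j.+3 then s j.+2 else e)
  _ _ _ _ _ _ _ _ _) => //=.
- by move=> [|i] H; [lia | apply: rp].
- move=> [|i] H; [by rewrite r0 | apply: rd; lia].
- by move=> [|[|i]] H //; apply: pp; lia.
- by move=> [|[|[|i]]] H //; apply: sp; lia.
- move=> [|[|i]] H //; first by rewrite subnn r0 r1.
  have := es i.+1; rewrite !subn1 /= => -> //; lia.
- by move: el n0; case: (n) => // k; rewrite !subn1.
Qed.

Lemma regular_method_exists x0 x1 : 0 < x1 < x0 ->
  exists A : euclid_algorithm x0 x1, regular_method A.
Proof.
elim/ltn_ind: x1 x0 => x1 IH x0 H.
have [dv|ndv] := boolP (x1 %| x0).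
  by have [A lA] := euclid_single H dv; exists A => i; rewrite lA; lia.
have r_gt0 : 0 < x0 %% x1 by rewrite lt0n.
have lt_r : x0 %% x1 < x1 by rewrite ltn_mod; lia.
have [|B rB] := IH (x0 %% x1) lt_r x1; first by rewrite r_gt0.
have q0 : 0 < x0 %/ x1 by rewrite divn_gt0; lia.
have E := divn_eq x0 x1.
have [||A [lA _ s2 s3]] := @euclid_cons x0 x1 _ _ 1%R B H q0; [by left | by lia |].
by exists A => -[|[|[|i]]] //; rewrite lA => Hi; rewrite s3; apply: rB.
Qed.

Lemma least_abs_rem_method_exists x0 x1 : 0 < x1 < x0 ->
  exists A : euclid_algorithm x0 x1, least_abs_rem_method A.
Proof.
elim/ltn_ind: x1 x0 => x1 IH x0 H.
have [dv|ndv] := boolP (x1 %| x0).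
  by have [A lA] := euclid_single H dv; exists A => i; rewrite lA; lia.
have r_gt0 : 0 < x0 %% x1 by rewrite lt0n.
have lt_r : x0 %% x1 < x1 by rewrite ltn_mod; lia.
have E := divn_eq x0 x1.
have q0 : 0 < x0 %/ x1 by rewrite divn_gt0; lia.
have [x2 [q [e [Hx2 q_gt0 he eE [le2 tie]]]]] : exists x2 q (e : int),
    [/\ 0 < x2 < x1, 0 < q, (e = 1 \/ e = -1)%R,
     (x0%:Z = x1%:Z * q%:Z + e * x2%:Z)%R
     & 2 * x2 <= x1 /\ (2 * x2 = x1 -> e = 1%R)].
  have [le|gt] := leqP (2 * (x0 %% x1)) x1.
    by exists (x0 %% x1), (x0 %/ x1), 1%R; split=> //; [lia | left | lia].
  exists (x1 - x0 %% x1), (x0 %/ x1).+1, (-1)%R.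
  by split; [lia | lia | right | nia | split; lia].
have lt21 : x2 < x1 by lia.
have [B rB] := IH x2 lt21 x1 Hx2.
have [A [lA rA s2 s3]] := euclid_cons B H q_gt0 he eE.
exists A => -[|[|[|i]]] //; rewrite lA subn1 /= !rA => Hi.
  by rewrite s2 rem_0 rem_1.
by rewrite s3; have := rB i.+2; rewrite subn1; apply.
Qed.

(* Main.v *)
Require Import Defs.
From mathcomp Require Import all_boot all_order all_algebra.
From mathcomp Require Import zify.

(** Let S(a,b) be the number of steps of the regular method on (a,b).
    It suffices that every equation [a = b q - c] with [0 < 2c < b], as used by
    least absolute remainders, costs the same as under S, i.e. that
    S(a,b) = q + 1 + S(b,c).  The regular method replaces that equation by
    [a = b (q-1) + (b-c)], [b = (b-c) 1 + c], so S(a,b) = q + 2 + S(b-c,c);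
    and S(b,c) = 1 + S(b-c,c), since adding the divisor to the dividend
    raises the first quotient by one.  At a tie [2c = b] this would fail,
    as the second division would then leave no remainder. *)

(* The fuel [n] is only meaningful when [b <= n]. *)
Fixpoint euclid_steps_rec (n a b : nat) : nat :=
  if n is n'.+1 then
    if b %| a then a %/ b else (a %/ b).+1 + euclid_steps_rec n' b (a %% b)
  else 0.

Definition euclid_steps (a b : nat) : nat := euclid_steps_rec b a b.

(** Divisors are positive and strictly decrease, so at most [b] divisions occur and fuel beyond [b]
    is never consumed. *)
Lemma euclid_steps_rec_fuel (n a b : nat) :
  0 < b <= n -> euclid_steps_rec n a b = euclid_steps a b.
Proof.
rewrite /euclid_steps; elim/ltn_ind: n a b => -[|n] IH a [|b] //= le_bn.
case: ifPn => // ndv.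
have r_gt0 : 0 < a %% b.+1 by rewrite lt0n.
have lt_r : a %% b.+1 < b.+1 by rewrite ltn_mod.
by rewrite (IH n) ?(IH b) //; lia.
Qed.

Lemma euclid_steps_mul (b q : nat) : 0 < b -> euclid_steps (b * q) b = q.
Proof. by case: b => // b _; rewrite /euclid_steps /= dvdn_mulr // mulKn. Qed.

Lemma euclid_steps_add (b q c : nat) : 0 < c < b ->
  euclid_steps (b * q + c) b = q + 1 + euclid_steps b c.
Proof.
case: b => [|b] /andP[c_gt0 lt_cb] //.
have modE : (b.+1 * q + c) %% b.+1 = c by rewrite mulnC modnMDl modn_small.
have divE : (b.+1 * q + c) %/ b.+1 = q by rewrite mulnC divnMDl // divn_small ?addn0.
rewrite {1}/euclid_steps /= /dvdn modE divE ifN; last by rewrite -lt0n.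
by rewrite euclid_steps_rec_fuel ?addn1 //; lia.
Qed.

Lemma euclid_steps_addl (a b : nat) : 0 < b ->
  euclid_steps (b + a) b = (euclid_steps a b).+1.
Proof.
move=> b_gt0; rewrite (divn_eq a b) [_ * b]mulnC addnA -mulnS.
have [->|r_neq0] := eqVneq (a %% b) 0; first by rewrite !addn0 !euclid_steps_mul.
by rewrite !euclid_steps_add ?lt0n ?r_neq0 ?ltn_mod.
Qed.

Lemma euclid_steps_sub (a b q c : nat) : 0 < c -> 2 * c < b -> 0 < q ->
  a + c = b * q -> euclid_steps a b = q + 1 + euclid_steps b c.
Proof.
case: q => // q c_gt0 lt_cb _ eq_a.
have -> : a = b * q + (b - c) by nia.
rewrite euclid_steps_add; last lia.
(* Since [2 * c < b], [c] is a genuine remainder modulo [b - c]. *)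
have first_eq : (b - c) * 1 + c = b by lia.
have -> : euclid_steps b (b - c) = 1 + 1 + euclid_steps (b - c) c.
  by rewrite -{1}first_eq euclid_steps_add //; lia.
have -> : euclid_steps b c = (euclid_steps (b - c) c).+1.
  by rewrite -euclid_steps_addl // subnKC //; lia.
lia.
Qed.

Lemma nb_steps_euclid_steps (x0 x1 : nat) (A : euclid_algorithm x0 x1) :
    (forall i, 1 <= i <= ea_len A - 1 ->
       euclid_steps (ea_rem A (i - 1)) (ea_rem A i)
       = ea_quo A i + 1 + euclid_steps (ea_rem A i) (ea_rem A i.+1)) ->
  nb_steps A = euclid_steps x0 x1.
Proof.
move=> step; have len_gt0 := len_gt0 A.
(* Covers the last [k + 1] equations, by induction from the final exact one; [k] counts the passages
   between them. *)
have tail k : k < ea_len A ->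
    k + \sum_(ea_len A - k <= i < (ea_len A).+1) ea_quo A i
    = euclid_steps (ea_rem A (ea_len A - k - 1)) (ea_rem A (ea_len A - k)).
  elim: k => [|k IH] lt_k.
    by rewrite subn0 big_nat1 eqn_last euclid_steps_mul // rem_gt0.
  have eq_k : ea_len A - k = (ea_len A - k.+1).+1 by lia.
  rewrite step; last lia.
  rewrite -eq_k big_ltn -?eq_k; last lia.
  have -> : ea_len A - k.+1 = ea_len A - k - 1 by lia.
  rewrite -IH; lia.
have := tail (ea_len A - 1); rewrite subKn // subnn rem_0 rem_1; apply; lia.
Qed.

Theorem theorem4p1 (x0 x1 : nat) (hx1 : 0 < x1) (hx : x1 < x0)
    (A B : euclid_algorithm x0 x1) :
  regular_method A -> least_abs_rem_method B -> nb_steps A = nb_steps B.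
Proof.
move=> regA larB; rewrite !nb_steps_euclid_steps // => i hi.
- have := eqn_step hi; have := larB i.+1; have := sgn_pm1 (e := B) (i := i.+1).
  have := @rem_gt0 _ _ B i.+1; have := @rem_decr _ _ B i; have := @quo_gt0 _ _ B i.
  rewrite (subn1 i.+1) /= => q_gt0 lt_r r_gt0 sgn lar.
  have {}q_gt0 := q_gt0 ltac:(lia); have {}lt_r := lt_r ltac:(lia).
  have {}r_gt0 := r_gt0 ltac:(lia).
  have [le_half tie] := lar ltac:(lia).
  have [sgnE|sgnE] := sgn ltac:(lia); rewrite sgnE => eq_i.
    rewrite -euclid_steps_add; last lia.
    by congr euclid_steps; lia.
  (* A tie would force the sign [+1], so the half bound is strict, as [euclid_steps_sub]
     requires. *)
  have no_tie : 2 * ea_rem B i.+1 <> ea_rem B i by move/tie; rewrite sgnE.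
  by apply: euclid_steps_sub; lia.
- have := eqn_step hi; rewrite regA; last lia.
  move=> eq_i; rewrite -euclid_steps_add; last by rewrite rem_gt0 ?rem_decr //; lia.
  by congr euclid_steps; lia.
Qed.
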